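(* Every MV-ring, every BL-ring, and every (commutative, unitary) Von Neumann regular ring is a multiplication ring.
   Context: A residuated lattice is an algebra $(L,\wedge,\vee,\odot,\rightarrow,0,1)$ such that $(L,\wedge,\vee,0,1)$ is a bounded lattice with order $\leq$, $(L,\odot,1)$ is a commutative ordered monoid, and $z\leq x\rightarrow y$ iff $x\odot z\leq y$ for all $x,y,z\in L$. Write $x^*=x\rightarrow 0$. A BL-algebra is a residuated lattice satisfying prelinearity $(x\rightarrow y)\vee(y\rightarrow x)=1$ and divisibility $x\odot(x\rightarrow y)=x\wedge y$ for all $x,y$. An MV-algebra is a BL-algebra in which $x^{**}=x$ for every $x$. For a commutative unitary ring $A$, the set $\mathrm{Id}(A)$ of ideals of $A$, ordered by inclusion, is a residuated lattice with meet $I\cap J$, join $I+J$, product $I\otimes J=\{\sum_{k=1}^n i_kj_k : i_k\in I, j_k\in J\}$, residuum $I\rightarrow J=(J:I)=\{x\in A: xI\subseteq J\}$, least element $\{0\}$ and greatest element $A$. A commutative unitary ring is an MV-ring (resp. BL-ring) if this residuated lattice is an MV-algebra (resp. a BL-algebra). A commutative unitary ring $A$ is Von Neumann regular if for every $x\in A$ there exists $a\in A$ with $x=a\cdot x^2$. An ideal $I$ of $A$ is a multiplication ideal if for every ideal $J\subseteq I$ there exists an ideal $K$ of $A$ such that $J=I\otimes K$. The ring $A$ is a multiplication ring if all its ideals are multiplication ideals. *)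

(* Defs.v *)
From HB Require Import structures.
From mathcomp Require Import all_boot all_order all_algebra.
From mathcomp Require Import boolp classical_sets.

Set Implicit Arguments.
Unset Strict Implicit.
Unset Printing Implicit Defensive.

Import Order.TTheory GRing.Theory.
Local Open Scope classical_set_scope.
Local Open Scope ring_scope.
Local Open Scope order_scope.

HB.mixin Record TBLattice_isResiduated (d : Order.disp_t) L
    of Order.TBLattice d L := {
  resmul : L -> L -> L;
  resimp : L -> L -> L;
  resmulA : associative resmul;
  resmulC : commutative resmul;
  resmul1 : left_id \top resmul;
  le_resmul2r : forall z x y : L, x <= y -> resmul x z <= resmul y z;
  resimpP : forall x y z : L, (z <= resimp x y) = (resmul x z <= y)
}.

#[short(type="residuatedLatticeType")]
HB.structure Definition ResiduatedLattice (d : Order.disp_t) :=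
  { L of TBLattice_isResiduated d L & Order.TBLattice d L }.

Definition resneg (d : Order.disp_t) (L : residuatedLatticeType d)
    (x : L) : L :=
  resimp x \bot.

Definition prelinear (d : Order.disp_t) (L : residuatedLatticeType d) : Prop :=
  forall x y : L, resimp x y `|` resimp y x = \top.

Definition divisible (d : Order.disp_t) (L : residuatedLatticeType d) : Prop :=
  forall x y : L, resmul x (resimp x y) = x `&` y.

Definition BL_algebra (d : Order.disp_t) (L : residuatedLatticeType d) : Prop :=
  prelinear L /\ divisible L.

Definition MV_algebra (d : Order.disp_t) (L : residuatedLatticeType d) : Prop :=
  BL_algebra L /\ forall x : L, resneg (resneg x) = x.

Section Ideals.
Local Open Scope ring_scope.

(* Unlike [idealr_closed] of [ring_quotient], the unit ideal is allowed and the
   base ring may be trivial. Closure under opposites follows from [(-1) * x]. *)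
Definition is_ideal (A : comPzRingType) (I : set A) : Prop :=
  [/\ I 0, forall x y, I x -> I y -> I (x + y) & forall a x, I x -> I (a * x)].

Record ideal (A : comPzRingType) := Ideal {
  ideal_set :> set A;
  ideal_setP : is_ideal ideal_set
}.

Variable A : comPzRingType.
Implicit Types I J K : ideal A.

HB.instance Definition _ := gen_eqMixin (ideal A).
HB.instance Definition _ := gen_choiceMixin (ideal A).

Lemma ideal_eq I J : ideal_set I = ideal_set J -> I = J.
Proof.
case: I J => [I hI] [J hJ] /= eIJ; move: hJ; rewrite -eIJ => hJ.
by rewrite (Prop_irrelevance hI hJ).
Qed.

Lemma ideal0 I : ideal_set I 0. Proof. by case: (ideal_setP I). Qed.

Lemma idealD I x y :
  ideal_set I x -> ideal_set I y -> ideal_set I (x + y).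
Proof. by case: (ideal_setP I) => _ h _; apply: h. Qed.

Lemma idealM I a x : ideal_set I x -> ideal_set I (a * x).
Proof. by case: (ideal_setP I) => _ _; apply. Qed.

Lemma ideal_sum I n (f : 'I_n -> A) :
  (forall k, ideal_set I (f k)) -> ideal_set I (\sum_(k < n) f k).
Proof.
by move=> If; elim/big_ind: _ => //; [exact: ideal0 | move=> *; exact: idealD].
Qed.

Fact zero_ideal_subproof : is_ideal [set 0 : A].
Proof. by split=> //= [x y -> ->|a x ->]; rewrite ?addr0 ?mulr0. Qed.
Definition zero_ideal := Ideal zero_ideal_subproof.

Fact unit_ideal_subproof : is_ideal [set: A].
Proof. by []. Qed.
Definition unit_ideal := Ideal unit_ideal_subproof.

Fact ideal_cap_subproof I J : is_ideal (I `&` J).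
Proof.
split=> [|x y [? ?] [? ?]|a x [? ?]]; split;
  by [exact: ideal0 | exact: idealD | exact: idealM].
Qed.
Definition ideal_cap I J := Ideal (ideal_cap_subproof I J).

Fact ideal_add_subproof I J :
  is_ideal [set x | exists i j, [/\ ideal_set I i, ideal_set J j & x = i + j]].
Proof.
split=> /= [|x y [i [j [Ii Jj ->]]] [k [l [Ik Jl ->]]]|a x [i [j [Ii Jj ->]]]].
- by exists 0, 0; split; [exact: ideal0 | exact: ideal0 | rewrite addr0].
- exists (i + k), (j + l).
  by split; [exact: idealD | exact: idealD | rewrite addrACA].
- exists (a * i), (a * j).
  by split; [exact: idealM | exact: idealM | rewrite mulrDr].
Qed.
Definition ideal_add I J := Ideal (ideal_add_subproof I J).

Fact ideal_prod_subproof I J :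
  is_ideal [set x | exists n (i j : 'I_n -> A),
    [/\ forall k, ideal_set I (i k), forall k, ideal_set J (j k) &
     x = \sum_(k < n) i k * j k]].
Proof.
split=> /= [|x y [n [i [j [Ii Jj ->]]]] [m [k [l [Ik Jl ->]]]]
           |a x [n [i [j [Ii Jj ->]]]]].
- by exists 0%N, (fun=> 0), (fun=> 0); split=> [?|?|];
    rewrite ?big_ord0 //; exact: ideal0.
- exists (n + m)%N,
    (fun r => match split r with inl s => i s | inr s => k s end),
    (fun r => match split r with inl s => j s | inr s => l s end).
  split=> [r|r|]; [by case: split | by case: split | ].
  rewrite big_split_ord /=; congr (_ + _); apply: eq_bigr => s _.
  + by rewrite (unsplitK (inl s : 'I_n + 'I_m)%type).
  + by rewrite (unsplitK (inr s : 'I_n + 'I_m)%type).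
- exists n, (fun s => a * i s), j; split=> // [s|]; first exact: idealM.
  by rewrite mulr_sumr; apply: eq_bigr => s _; rewrite mulrA.
Qed.
Definition ideal_prod I J := Ideal (ideal_prod_subproof I J).

Fact ideal_res_subproof I J :
  is_ideal [set x | forall i, ideal_set I i -> ideal_set J (x * i)].
Proof.
split=> /= [i _|x y hx hy i Ii|a x hx i Ii].
- by rewrite mul0r; exact: ideal0.
- by rewrite mulrDl; apply: idealD; [exact: hx | exact: hy].
- by rewrite -mulrA; apply/idealM/hx.
Qed.
Definition ideal_res I J := Ideal (ideal_res_subproof I J).

Definition ideal_le I J : bool := `[< I `<=` J >].

Lemma ideal_leP I J : reflect (I `<=` J) (ideal_le I J).
Proof. exact: asboolP. Qed.

Fact ideal_le_refl : reflexive ideal_le.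
Proof. by move=> I; apply/ideal_leP. Qed.

Fact ideal_le_anti : antisymmetric ideal_le.
Proof.
by move=> I J /andP[/ideal_leP IJ /ideal_leP JI]; apply/ideal_eq/seteqP.
Qed.

Fact ideal_le_trans : transitive ideal_le.
Proof.
move=> J I K /ideal_leP IJ /ideal_leP JK.
by apply/ideal_leP; exact: subset_trans IJ JK.
Qed.

End Ideals.

Fact ideal_display : Order.disp_t. Proof. exact: Order.Disp tt tt. Qed.

HB.instance Definition _ (A : comPzRingType) :=
  Order.Le_isPOrder.Build ideal_display (ideal A)
    (@ideal_le_refl A) (@ideal_le_anti A) (@ideal_le_trans A).

Section IdealLattice.
Local Open Scope ring_scope.
Variable A : comPzRingType.
Implicit Types I J K : ideal A.

Lemma ideal_leE I J : (I <= J)%O = `[< I `<=` J >].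
Proof. by []. Qed.

Fact le_ideal_cap K I J : (K <= ideal_cap I J)%O = (K <= I)%O && (K <= J)%O.
Proof.
rewrite !ideal_leE /=; apply/asboolP/andP => [KIJ|[/asboolP KI /asboolP KJ]].
  by split; apply/asboolP => x /KIJ[].
by move=> x Kx; split; [exact: KI | exact: KJ].
Qed.

Fact ideal_add_le I J K : (ideal_add I J <= K)%O = (I <= K)%O && (J <= K)%O.
Proof.
rewrite !ideal_leE /=; apply/asboolP/andP => [IJK|[/asboolP IK /asboolP JK]].
  split; apply/asboolP => x ?; apply: IJK.
    by exists x, 0; split; [ | exact: ideal0 | rewrite addr0].
  by exists 0, x; split; [exact: ideal0 | | rewrite add0r].
by move=> _ [i [j [/IK Ki /JK Kj ->]]]; exact: idealD.
Qed.

Fact zero_ideal_le I : (zero_ideal A <= I)%O.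
Proof. by rewrite ideal_leE; apply/asboolP => _ ->; exact: ideal0. Qed.

Fact le_unit_ideal I : (I <= unit_ideal A)%O.
Proof. by rewrite ideal_leE; apply/asboolP. Qed.

Lemma ideal_le_eq I J : (forall K, (I <= K)%O = (J <= K)%O) -> I = J.
Proof. by move=> h; apply: le_anti; rewrite h lexx -h lexx. Qed.

Lemma ideal_prod_leP I J K : reflect
  (forall i j, ideal_set I i -> ideal_set J j -> ideal_set K (i * j))
  (ideal_prod I J <= K)%O.
Proof.
apply: (iffP (ideal_leP _ _)) => [h i j Ii Jj|h _ [n [i [j [Ii Jj ->]]]]].
  by apply: h; exists 1%N, (fun=> i), (fun=> j); split=> //; rewrite big_ord1.
by apply: ideal_sum => k; exact: h.
Qed.

Fact ideal_prodC : commutative (@ideal_prod A).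
Proof.
move=> I J; apply: ideal_le_eq => K.
by apply/ideal_prod_leP/ideal_prod_leP => h i j Ii Jj; rewrite mulrC; exact: h.
Qed.

Fact ideal_resP I J K : (K <= ideal_res I J)%O = (ideal_prod I K <= J)%O.
Proof.
rewrite ideal_leE; apply/asboolP/ideal_prod_leP => [h i k Ii Kk|h k Kk i Ii].
  by rewrite mulrC; exact: h.
by rewrite mulrC; exact: h.
Qed.

Fact ideal_prodA : associative (@ideal_prod A).
Proof.
move=> I J K; apply: ideal_le_eq => M.
rewrite -ideal_resP [ideal_prod (ideal_prod I J) K]ideal_prodC -[RHS]ideal_resP.
apply/ideal_prod_leP/ideal_prod_leP => [h i j Ii Jj k Kk|h j k Jj Kk i Ii].
  by rewrite -mulrA mulrC; exact: h.
by rewrite mulrC mulrA; exact: h.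
Qed.

Fact ideal_prod1 : left_id (unit_ideal A) (@ideal_prod A).
Proof.
move=> I; apply: ideal_le_eq => K; rewrite [RHS]ideal_leE.
apply/ideal_prod_leP/asboolP => [h i Ii|IK a i _ Ii].
  by rewrite -[i]mul1r; exact: h.
by apply: idealM; exact: IK.
Qed.

Fact le_ideal_prod2r K I J :
  (I <= J)%O -> (ideal_prod I K <= ideal_prod J K)%O.
Proof.
rewrite ideal_leE => /asboolP IJ; apply/ideal_prod_leP => i k Ii Kk.
have /ideal_prod_leP : (ideal_prod J K <= ideal_prod J K)%O by [].
by apply=> //; exact: IJ.
Qed.

End IdealLattice.

HB.instance Definition _ (A : comPzRingType) :=
  Order.POrder_MeetJoin_isLattice.Build ideal_display (ideal A)
    (@le_ideal_cap A) (@ideal_add_le A).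

HB.instance Definition _ (A : comPzRingType) :=
  Order.hasBottom.Build ideal_display (ideal A) (@zero_ideal_le A).

HB.instance Definition _ (A : comPzRingType) :=
  Order.hasTop.Build ideal_display (ideal A) (@le_unit_ideal A).

HB.instance Definition _ (A : comPzRingType) :=
  TBLattice_isResiduated.Build ideal_display (ideal A)
    (@ideal_prodA A) (@ideal_prodC A) (@ideal_prod1 A)
    (@le_ideal_prod2r A) (@ideal_resP A).

Definition MV_ring (A : comPzRingType) : Prop := MV_algebra (ideal A).

Definition BL_ring (A : comPzRingType) : Prop := BL_algebra (ideal A).

Definition von_neumann_regular (A : comPzRingType) : Prop :=
  forall x : A, exists a : A, x = (a * x ^+ 2)%R.

Definition multiplication_ideal (A : comPzRingType) (I : ideal A) : Prop :=
  forall J : ideal A, J `<=` I -> exists K : ideal A, J = ideal_prod I K.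

Definition multiplication_ring (A : comPzRingType) : Prop :=
  forall I : ideal A, multiplication_ideal I.

(* Main.v *)
Require Import Defs.
From mathcomp Require Import all_boot all_order all_algebra.
From mathcomp Require Import boolp.

Import Order.TTheory GRing.Theory.

(** For [J] contained in [I], one has to find a cofactor [K] with [J = I K].
    In a BL-ring, hence in an MV-ring, divisibility of the ideal lattice says
    that [I (J : I)] is the intersection of [I] and [J], that is [J]; so
    [K = (J : I)] works.  In a Von Neumann regular ring [K = J] works, because
    [x = a * x ^+ 2 = x * (a * x)] writes each [x] in [J] as a product of an
    element of [I] and an element of [J]. *)

Lemma divisible_multiplication_ring (A : comPzRingType) :
  divisible (ideal A) -> multiplication_ring A.
Proof.
move=> divA I J JI; exists (ideal_res I J).
have leJI : (J <= I)%O by rewrite ideal_leE; apply/asboolP.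
by rewrite -[RHS]/(resmul I (resimp I J)) divA; apply/esym/meet_r.
Qed.

Lemma von_neumann_regular_multiplication_ring (A : comPzRingType) :
  von_neumann_regular A -> multiplication_ring A.
Proof.
move=> regA I J JI; exists J; apply: (@le_anti _ (ideal A)); apply/andP; split.
  apply/ideal_leP => x Jx; have [a ->] := regA x.
  have /ideal_prod_leP IJ : (ideal_prod I J <= ideal_prod I J)%O by [].
  rewrite expr2 mulrCA; apply: IJ; first exact: JI.
  exact: idealM.
by apply/ideal_prod_leP => i j _; exact: idealM.
Qed.

Theorem proposition10 (A : comPzRingType) :
  (MV_ring A -> multiplication_ring A) /\
  (BL_ring A -> multiplication_ring A) /\
  (von_neumann_regular A -> multiplication_ring A).
Proof.
split; [|split].
- by move=> [[_ divA] _]; exact: divisible_multiplication_ring.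
- by move=> [_ divA]; exact: divisible_multiplication_ring.
- exact: von_neumann_regular_multiplication_ring.
Qed.
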